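(* Let $G$ be a closed oligomorphic permutation group on a countable set $E$. Then $\mathrm{sib}(G)$ is one or infinite. That is, either the weak-equivalence class of $E$ coincides with the equivalence class of $E$ (which is the set of $G$-copies), or the weak-equivalence class of $E$ is the union of infinitely many equivalence classes. In the first case there is a partition of $E$ into finitely many sets such that every permutation of $E$ which preserves each block of the partition belongs to $G$.
   Context: Let $G$ be a group of permutations of a set $E$. $G$ is oligomorphic if for every integer $n$ the number of $G$-orbits of $n$-element subsets of $E$ is finite. For $A,A'\subseteq E$, a map $f$ with domain $A$ and image $A'$ is a $G$-local embedding if for every finite $F\subseteq A$ there is $g\in G$ with $g_{\restriction F}=f_{\restriction F}$. It is a $G$-embedding if $A=E$, and a $G$-automorphism if moreover $A'=E$. $G$ is closed if every $G$-automorphism belongs to $G$. Two subsets of $E$ are equivalent if each is the image of the other by some $G$-local embedding; they are weakly equivalent if each contains the image of the other by some $G$-local embedding. A $G$-copy is the image of $E$ under some $G$-embedding, i.e. a member of the equivalence class of $E$. A $G$-sibling is a subset of $E$ which contains a $G$-copy, i.e. a subset weakly equivalent to $E$. $\mathrm{sib}(G)$ is the number of equivalence classes of $G$-siblings. *)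

(* Defs.v *)
From mathcomp Require Import all_boot all_order all_classical.

Set Implicit Arguments.
Unset Strict Implicit.
Unset Printing Implicit Defensive.

Local Open Scope classical_set_scope.
Local Open Scope card_scope.

(* A group of permutations of the possibly infinite set E is given by the set
   of its elements, as functions E -> E. *)
Definition perm_group (E : Type) (G : set (E -> E)) : Prop :=
  [/\ forall g, G g -> bijective g,
      G id,
      forall g h, G g -> G h -> G (g \o h) &
      forall g h, G g -> cancel g h -> cancel h g -> G h].

Definition orbit_of (E : Type) (G : set (E -> E)) (A : set E) : set (set E) :=
  [set B | exists2 g, G g & B = g @` A].

Definition oligomorphic (E : Type) (G : set (E -> E)) : Prop :=
  forall n : nat, finite_set (orbit_of G @` [set A | A #= `I_n]).

(* A map with domain A is represented by a total function E -> E of which only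
   the values on A are used. This loses no map A -> A' with A, A' subsets of E:
   extend it by the identity outside A. *)
Definition local_embedding (E : Type) (G : set (E -> E)) (A A' : set E)
    (f : E -> E) : Prop :=
  f @` A = A' /\
  forall F : set E, finite_set F -> F `<=` A ->
    exists2 g, G g & forall x, F x -> g x = f x.

Definition embedding (E : Type) (G : set (E -> E)) (f : E -> E) : Prop :=
  exists A' : set E, local_embedding G setT A' f.

Definition automorphism (E : Type) (G : set (E -> E)) (f : E -> E) : Prop :=
  local_embedding G setT setT f.

Definition closed_group (E : Type) (G : set (E -> E)) : Prop :=
  forall f, automorphism G f -> G f.

Definition equivalent (E : Type) (G : set (E -> E)) (A B : set E) : Prop :=
  (exists f, local_embedding G A B f) /\ (exists f, local_embedding G B A f).

Definition weakly_equivalent (E : Type) (G : set (E -> E)) (A B : set E) :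
    Prop :=
  (exists f, exists2 C, local_embedding G A C f & C `<=` B) /\
  (exists f, exists2 C, local_embedding G B C f & C `<=` A).

Definition equivalence_class (E : Type) (G : set (E -> E)) (A : set E) :
    set (set E) :=
  [set B | equivalent G A B].

Definition weak_class (E : Type) (G : set (E -> E)) (A : set E) :
    set (set E) :=
  [set B | weakly_equivalent G A B].

Definition copies (E : Type) (G : set (E -> E)) : set (set E) :=
  [set C | exists2 f, embedding G f & C = f @` setT].

Definition siblings (E : Type) (G : set (E -> E)) : set (set E) :=
  [set S | exists2 C, copies G C & C `<=` S].

(* sib(G) is the cardinality of this set. *)
Definition sib_classes (E : Type) (G : set (E -> E)) : set (set (set E)) :=
  equivalence_class G @` siblings G.

(* Main.v *)
Require Import Defs.
From mathcomp Require Import all_boot all_order all_classical finmap.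

(** The proof compares two relations on [E].  Call [x] and [y] _similar_ when
the transposition of [x] and [y] belongs to [G].  For a subset [S] of [E], call
two points [x] and [y] of [S] _adjacent in [S]_ when every finite part of [S]
avoiding both is fixed pointwise by some element of [G] sending [x] to [y].
Adjacency in [S] is an invariant of the equivalence class of [S], and so are
the sizes of its finite connected components.  In [S = E] it coincides with
similarity ([adj_setT_sim]; this uses that [G] is a group and closed), hence it
is transitive there; in a smaller [S] it need not be.

_Finitely many similarity classes._  A closed group containing the
transpositions inside the classes contains all permutations preserving the
classes ([sim_emb]), so the classes form the partition that is asked for.  An
embedding [f] permutes the finitely many classes, so some power of [f] returns
each point to its class; a Cantor-Bernstein argument then makes every sibling
a copy ([sibling_is_copy]).

_Infinitely many similarity classes._  Here, for every large [n], there is a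
sibling with a finite component of size at least [n], and whose finite
components all have size at most [n + m], with [m] independent of [n]
([siblings_large_components]).  As the invariants differ, infinitely many
siblings are inequivalent.  To construct them, fix an ultrafilter [U] on [E]
containing the complement of each similarity class.  Since [G] is
oligomorphic, a [U]-generic point has a well-defined type over any finite set,
and one can adjoin to a copy of [E] a new point realising it
([limit_point]).  Iterating [n] times, and always taking the new point generic
over all the previous ones, yields a sibling [f(E) + {a_1, .., a_n}] in which
consecutive [a_i] are adjacent ([tower_succ]).  The points [f x] that are
adjacent to some [a_i] come from points [x] which are themselves limits of
[U]-generic points; those belong to one similarity
class ([is_limit_unique]).

- If that class is finite, the component of the [a_i] is finite and the tower
  is the desired sibling ([sibling_of_tower]).
- If a limit point lies in an infinite class [K], then each point of [K] can be
  traded for a generic point outside [K], so that [E] embeds in [E \ K]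
  ([limit_avoid]).  Hence removing from [E] all but [n] points of [K] leaves a
  sibling, in which the remaining [n] points form a component
  ([sibling_trimmed_class]). *)

Set Implicit Arguments.
Unset Strict Implicit.
Unset Printing Implicit Defensive.

Local Open Scope classical_set_scope.
Local Open Scope card_scope.

(** * Transpositions and finite sizes *)

Section Swap.
Context (E : choiceType).

Definition swap (x y : E) : E -> E :=
  fun z => if z == x then y else if z == y then x else z.

Lemma swapL x y : swap x y x = y.
Proof. by rewrite /swap eqxx. Qed.

Lemma swapR x y : swap x y y = x.
Proof. by rewrite /swap eqxx; case: eqP. Qed.

Lemma swapD x y z : z != x -> z != y -> swap x y z = z.
Proof. by rewrite /swap => /negPf-> /negPf->. Qed.

Lemma swapC x y : swap x y = swap y x.
Proof.
by apply/funext => z; rewrite /swap; do 2 case: eqP => // ->.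
Qed.

Lemma swapxx x : swap x x = id.
Proof. by apply/funext => z; rewrite /swap; case: eqP => // ->. Qed.

Lemma swapK x y : involutive (swap x y).
Proof.
move=> z; have [->|zx] := eqVneq z x; first by rewrite swapL swapR.
have [->|zy] := eqVneq z y; first by rewrite swapR swapL.
by rewrite !swapD.
Qed.

Lemma swap_conj (g h : E -> E) x y : cancel g h -> cancel h g ->
  swap (g x) (g y) = g \o swap x y \o h.
Proof.
move=> gK hK; apply/funext => z /=; rewrite -{1}(hK z) /swap.
by rewrite !(inj_eq (can_inj gK)); do 2 case: ifP => // _; rewrite hK.
Qed.

Definition small k (A : set E) :=
  exists2 s : seq E, (size s <= k)%N & forall x, A x -> x \in s.

Definition large k (A : set E) :=
  exists s : seq E, [/\ uniq s, size s = k & forall x, x \in s -> A x].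

Lemma small_large k n A : small k A -> large n A -> (n <= k)%N.
Proof.
move=> [s sk As] [r [ur <- rA]]; apply: leq_trans sk.
by apply: uniq_leq_size => // x /rA/As.
Qed.

Lemma sub_small k A B : A `<=` B -> small k B -> small k A.
Proof. by move=> AB [s sk Bs]; exists s => // x /AB/Bs. Qed.

Lemma leq_small k l A : (k <= l)%N -> small k A -> small l A.
Proof. by move=> kl [s sk Bs]; exists s => //; exact: leq_trans kl. Qed.

Lemma smallU k l A B : small k A -> small l B -> small (k + l) (A `|` B).
Proof.
move=> [s sk As] [r rl Br]; exists (s ++ r).
  by rewrite size_cat leq_add.
by move=> x [/As|/Br]; rewrite mem_cat => ->; rewrite ?orbT.
Qed.

Lemma small_image k A (f : E -> E) : small k A -> small k (f @` A).
Proof.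
move=> [s sk As]; exists (map f s); first by rewrite size_map.
by move=> _ [x /As xs <-]; exact: map_f.
Qed.

(** Needed with a bound [k] on [B] rather than on the image of [f]: the points of
[B] that [f] does not reach are dropped from the list one by one. *)
Lemma small_preimage k A B (f : E -> E) : injective f ->
  (forall x, A x -> B (f x)) -> small k B -> small k A.
Proof.
move=> fI AB [s sk Bs]; elim: s k A B sk AB Bs => [|y s IHs] k A B sk AB Bs.
  by exists [::] => // x /AB/Bs.
have [[x fxy]|nx] := pselect (exists x, f x = y); last first.
  apply: (IHs k (A) (B `\ y)).
  - exact: ltnW.
  - by move=> x Ax; split; [exact: AB|move=> fxy; apply: nx; exists x].
  - by move=> z [/Bs]; rewrite inE => /orP[/eqP-> []|].
case: k sk => // k sk.
have [|z [Az zx]|z [/Bs]|r rk Ar] := IHs k (A `\ x) (B `\ y).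
- exact: sk.
- by split; [exact: AB|move=> fzy; apply: zx; apply: fI; rewrite fxy].
- by rewrite inE => /orP[/eqP-> []|].
exists (x :: r) => // z Az; rewrite inE.
by have [//|/eqP zx] := eqVneq z x; exact: Ar.
Qed.

Lemma large_infinite A : ~ (exists k, small k A) -> forall n, large n A.
Proof.
move=> inf; elim=> [|n [s [us sn sA]]]; first by exists [::].
have [[x [Ax xs]]|nx] := pselect (exists x, A x /\ x \notin s).
  exists (x :: s); split => /=; [by rewrite xs|by rewrite sn|].
  by move=> z; rewrite inE => /orP[/eqP->|/sA].
exfalso; apply: inf; exists n; exists s; first by rewrite sn.
by move=> x Ax; apply: contrapT => /negP xs; apply: nx; exists x.
Qed.

End Swap.

(** * Types over finite sets, similarity and adjacency *)

Section Group.
Context (E : choiceType) (G : set (E -> E)).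
Hypothesis groupG : perm_group G.

Lemma G_id : G id. Proof. by case: groupG. Qed.

Lemma G_comp g h : G g -> G h -> G (g \o h).
Proof. by case: groupG => _ _ + _; apply. Qed.

Lemma G_inv g : G g -> exists h, [/\ G h, cancel g h & cancel h g].
Proof.
by case: groupG => bG _ _ iG Gg; have [h gK hK] := bG _ Gg; exists h; split => //;
  exact: (iG g).
Qed.

Lemma G_inj g : G g -> injective g.
Proof. by move=> /G_inv[h [_ gK _]]; exact: can_inj gK. Qed.

Definition same_type (s : seq E) (x y : E) :=
  exists g, [/\ G g, {in s, g =1 id} & g x = y].

Lemma same_type_refl s x : same_type s x x.
Proof. by exists id; split => //; exact: G_id. Qed.

Lemma same_type_sym s x y : same_type s x y -> same_type s y x.
Proof.
move=> [g [Gg gs <-]]; have [h [Gh gK hK]] := G_inv Gg.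
by exists h; split => // z zs; rewrite -{1}(gs z zs) gK.
Qed.

Lemma same_type_trans s x y z :
  same_type s x y -> same_type s y z -> same_type s x z.
Proof.
move=> [g [Gg gs <-]] [h [Gh hs <-]]; exists (h \o g); split => //.
  exact: G_comp.
by move=> t ts /=; rewrite gs // hs.
Qed.

Lemma same_type_sub s r x y :
  {subset s <= r} -> same_type r x y -> same_type s x y.
Proof. by move=> sr [g [Gg gr gx]]; exists g; split => // z /sr/gr. Qed.

Definition sim (x y : E) := G (swap x y).

Lemma sim_refl x : sim x x.
Proof. by rewrite /sim swapxx; exact: G_id. Qed.

Lemma sim_sym x y : sim x y -> sim y x.
Proof. by rewrite /sim swapC. Qed.

Lemma sim_move g x y : G g -> sim x y <-> sim (g x) (g y).
Proof.
move=> Gg; have [h [Gh gK hK]] := G_inv Gg; rewrite /sim; split => Gs.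
  by rewrite (swap_conj x y gK hK); apply: G_comp => //; exact: G_comp.
rewrite -(gK x) -(gK y) (swap_conj (g x) (g y) hK gK).
by apply: G_comp => //; exact: G_comp.
Qed.

Lemma sim_trans x y z : sim x y -> sim y z -> sim x z.
Proof.
have [->//|xy] := eqVneq x y.
have [->//|xz] := eqVneq x z; first by move=> _ _; exact: sim_refl.
have [->//|yz] := eqVneq y z.
move=> sxy syz; have := (sim_move x y syz).1 sxy.
by rewrite swapL (@swapD _ y z x).
Qed.

Lemma sim_same_type s x y :
  sim x y -> x \notin s -> y \notin s -> same_type s x y.
Proof.
move=> sxy xs ys; exists (swap x y); split => //; last exact: swapL.
by move=> z zs; apply: swapD; [apply: contraNneq xs|apply: contraNneq ys] => <-.
Qed.

(** Local embeddings, with the finite sets given by lists so that one can argue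
by induction on them; [emb] is the case of the full domain. *)
Definition loc (S : set E) (f : E -> E) :=
  forall s : seq E, (forall z, z \in s -> S z) -> exists2 g, G g & {in s, g =1 f}.

Definition emb (f : E -> E) := forall s : seq E, exists2 g, G g & {in s, g =1 f}.

Lemma embP f : emb f <-> loc setT f.
Proof. by split=> + s; [move=> /(_ s)|move=> /(_ s); exact]. Qed.

Lemma emb_G g : G g -> emb g.
Proof. by move=> Gg s; exists g. Qed.

Lemma emb_comp f g : emb f -> emb g -> emb (f \o g).
Proof.
move=> ef eg s; have [h Gh hs] := eg s; have [k Gk ks] := ef (map g s).
exists (k \o h); first exact: G_comp.
by move=> z zs /=; rewrite hs // ks //; exact: map_f.
Qed.

Lemma emb_iter n f : emb f -> emb (iter n f).
Proof. by move=> ef; elim: n => [|n IHn] /=; [exact: emb_G G_id|exact: emb_comp]. Qed.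

Lemma loc_inj S f x y : loc S f -> S x -> S y -> f x = f y -> x = y.
Proof.
move=> lf Sx Sy; have [z|g Gg gs] := lf [:: x; y].
  by rewrite !inE => /orP[]/eqP->.
by rewrite -!gs ?inE ?eqxx ?orbT // => /(G_inj Gg).
Qed.

Lemma emb_inj f : emb f -> injective f.
Proof. by move=> /embP lf x y; exact: (loc_inj lf). Qed.

Lemma emb_sim f x y : emb f -> sim x y <-> sim (f x) (f y).
Proof.
move=> ef; have [g Gg gs] := ef [:: x; y].
by rewrite -!gs ?inE ?eqxx ?orbT //; exact: sim_move.
Qed.

(** Only the points of [S] other than [x] and [y] are used as parameters, so that
local embeddings of [S] preserve adjacency.  The relation is
symmetric but in general not transitive: in a chain of points it holds
between neighbours. *)
Definition adj (S : set E) (x y : E) :=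
  [/\ S x, S y & forall s : seq E,
     (forall z, z \in s -> [/\ S z, z != x & z != y]) -> same_type s x y].

Lemma adj_sym S x y : adj S x y -> adj S y x.
Proof.
move=> [Sx Sy h]; split => // s hs; apply: same_type_sym; apply: h => z /hs[].
by split.
Qed.

(** Connected components for adjacency, as least sets closed under it. *)
Definition component (S : set E) (x y : E) :=
  forall W : set E, W x -> (forall u v, W u -> adj S u v -> W v) -> W y.

Lemma component_refl S x : component S x x. Proof. by move=> W. Qed.

Lemma component_step S x y z : component S x y -> adj S y z -> component S x z.
Proof. by move=> cxy ayz W Wx cW; apply: (cW y) => //; exact: cxy. Qed.

Lemma component_trans S x y z :
  component S x y -> component S y z -> component S x z.
Proof. by move=> cxy cyz W Wx cW; apply: cyz => //; exact: cxy. Qed.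

Lemma component_mem S x y : S x -> component S x y -> S y.
Proof. by move=> Sx; apply => // u v _ []. Qed.

(** The invariant that separates the siblings. *)
Definition big_component n S := exists x, [/\ S x, exists k, small k (component S x) &
  large n (component S x)].

Lemma loc_adj S f x y : loc S f -> S x -> S y ->
  adj S x y <-> adj (f @` S) (f x) (f y).
Proof.
move=> lf Sx Sy; split => -[_ _ axy]; split => //.
- move=> s hs.
  have [r rS] : exists r, [/\ forall z, z \in r -> [/\ S z, z != x & z != y] &
      s = map f r].
    elim: s hs => [_|z s IHs hs]; first by exists [::].
    have [|r [rS ->]] := IHs.
      by move=> t ts; apply: hs; rewrite inE ts orbT.
    have [[t St tz] zx zy] := hs z (mem_head _ _); exists (t :: r).
    split; last by rewrite /= tz.
    move=> w; rewrite inE => /orP[/eqP->|/rS//]; split => //.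
      by apply: contraNneq zx => <-; rewrite -tz.
    by apply: contraNneq zy => <-; rewrite -tz.
  have [rP ->] := rS; have [g [Gg gr gx]] := axy r rP.
  have [z|k Gk ks] := lf [:: x, y & r].
    by rewrite !inE => /or3P[/eqP->|/eqP->|/rP[]].
  have [k' [Gk' kK k'K]] := G_inv Gk.
  exists (k \o g \o k'); split.
  + by apply: G_comp => //; exact: G_comp.
  + move=> _ /mapP[z zr ->] /=; rewrite -ks ?inE ?zr ?orbT //.
    by rewrite kK gr.
  + by rewrite /= -ks ?inE ?eqxx // kK gx ks // !inE eqxx orbT.
- move=> s hs.
  have [z|k Gk ks] := lf [:: x, y & s].
    by rewrite !inE => /or3P[/eqP->|/eqP->|/hs[]].
  have [k' [Gk' kK k'K]] := G_inv Gk.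
  have [|g [Gg gs gx]] := axy (map f s).
    move=> _ /mapP[z zs ->]; have [Sz zx zy] := hs _ zs; split.
    + by exists z.
    + by apply: contraNneq zx => /(loc_inj lf Sz Sx)->.
    + by apply: contraNneq zy => /(loc_inj lf Sz Sy)->.
  exists (k' \o g \o k); split.
  + by apply: G_comp => //; exact: G_comp.
  + move=> z zs /=; rewrite ks ?inE ?zs ?orbT // gs; last exact: map_f.
    by rewrite -ks ?inE ?zs ?orbT.
  + by rewrite /= ks ?inE ?eqxx // gx -ks ?inE ?eqxx ?orbT.
Qed.

Lemma loc_big_component S f n :
  loc S f -> big_component n S -> big_component n (f @` S).
Proof.
move=> lf [x [Sx [k sk] [s [us sn sC]]]]; exists (f x).
have fC y : component (f @` S) (f x) y -> (f @` component S x) y.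
  apply; first by exists x => //; exact: component_refl.
  move=> _ v [z cz <-] /[dup] -[_ [w Sw <-] _] a; exists w => //.
  apply: (component_step cz); apply/(loc_adj lf) => //; exact: component_mem cz.
split; first by exists x.
- by exists k; apply: sub_small fC _; exact: small_image.
- exists (map f s); split; last 2 first.
  + by rewrite size_map.
  + move=> _ /mapP[y /sC cy ->].
    suff [] : (S `&` [set y | component (f @` S) (f x) (f y)]) y by [].
    apply: cy; first by split => //; exact: component_refl.
    move=> u v [Su cu] a; have [_ Sv _] := a; split => //=.
    by apply: (component_step cu); apply/(loc_adj lf).
  + rewrite map_inj_in_uniq // => y z /sC cy /sC cz.
    by apply: (loc_inj lf); [move: cy|move: cz]; exact: component_mem.
Qed.

End Group.

Section Closed.
Context (E : choiceType) (G : set (E -> E)).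
Hypothesis groupG : perm_group G.

Lemma local_embeddingP (A A' : set E) f :
  local_embedding G A A' f <-> f @` A = A' /\ loc G A f.
Proof.
split=> -[fA lf]; split => //.
  move=> s sA; have [g Gg gs] := lf [set` s] (finite_seq s) sA.
  by exists g.
move=> F /finite_seqP[s ->] sA; have [g Gg gs] := lf s sA.
by exists g.
Qed.

Lemma loc_inverse (S : set E) f : loc G S f ->
  exists2 f', loc G (f @` S) f' & f' @` (f @` S) = S.
Proof.
move=> lf.
have /choice[f' f'P] : forall y, exists x, (f @` S) y -> S x /\ f x = y.
  move=> y; have [[x Sx fx]|n] := pselect ((f @` S) y); first by exists x.
  by exists y.
have f'K x : S x -> f' (f x) = x.
  move=> Sx; have [//|Sf ff] := f'P (f x).
  exact: (loc_inj groupG lf).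
exists f'.
  move=> s sS; have [_ /mapP[y ys ->]|g Gg gs] := lf (map f' s).
    by have [] := f'P _ (sS _ ys).
  have [h [Gh gK hK]] := G_inv groupG Gg; exists h => // y ys.
  by have [_ {1}<-] := f'P _ (sS _ ys); rewrite -gs ?map_f ?gK.
apply/seteqP; split => [_ [_ [x Sx <-] <-]|x Sx]; first by rewrite f'K.
by exists (f x); [exists x|exact: f'K].
Qed.

Lemma loc_comp (S : set E) f g : loc G S f -> loc G (f @` S) g ->
  loc G S (g \o f).
Proof.
move=> lf lg s sS; have [h Gh hs] := lf s sS.
have [_ /mapP[z /sS Sz ->]//|k Gk ks] := lg (map f s).
exists (k \o h); first exact: G_comp.
by move=> z zs /=; rewrite hs // ks //; exact: map_f.
Qed.

Lemma loc_id (S : set E) : loc G S id.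
Proof. by move=> s _; exists id => //; exact: G_id. Qed.

Hypothesis closedG : closed_group G.

Lemma closed_mem f : emb G f -> (forall y, exists x, f x = y) -> G f.
Proof.
move=> ef sf; apply: closedG; apply/local_embeddingP; split.
  by apply/seteqP; split => // y _; have [x <-] := sf y; exists x.
exact/embP.
Qed.

(** Let [g] fix [s] and send [x] to [y], and set [z = g y].  Adjacency over
[z :: s] shows that [(x, y)] and [(x, z)] have the same type over [s], say by
[k].  Pulling [y] back by [k], using adjacency over the resulting parameter and
going forward again sends [x] to [z] with [y] fixed, so [(x, y)] and [(z, y)] have
the same type over [s].  Composing with the inverse of [g], which sends [(z, y)] to
[(y, x)], gives the required exchange. *)
Lemma adj_setT_swap x y (s : seq E) :
  adj G setT x y -> x \notin s -> y \notin s ->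
  exists g, [/\ G g, {in s, g =1 id}, g x = y & g y = x].
Proof.
have Gc := @G_comp E G groupG; have Gi := @G_inv E G groupG.
move=> [_ _ axy] xs ys.
have m (r : seq E) : x \notin r -> y \notin r -> same_type G r x y.
  move=> xr yr; apply: axy => z zr; split => //.
    by apply: contraNneq xr => <-.
  by apply: contraNneq yr => <-.
have [g [Gg gs gx]] := m s xs ys.
have [g' [Gg' gK g'K]] := Gi _ Gg.
have [gyx|y'x] := eqVneq (g y) x; first by exists g.
have [gyy|y'y] := eqVneq (g y) y.
  by exists g; split => //; apply: (G_inj groupG Gg); rewrite gx gyy.
have [||h [Gh hs hx]] := m (g y :: s); rewrite ?inE ?negb_or 1?eq_sym ?y'x ?y'y//.
(* [k] fixes [s] and sends [(x, y)] to [(x, g y)] *)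
have [h' [Gh' hK h'K]] := Gi _ Gh.
pose k := h' \o g.
have Gk : G k by exact: Gc.
have [k' [Gk' kK k'K]] := Gi _ Gk.
have kx : k x = x by rewrite /k /= gx -hx hK.
have ky : k y = g y.
  by rewrite /k /= -[in LHS](hs (g y)) ?hK ?mem_head.
have ks z : z \in s -> k z = z.
  by move=> zs; rewrite /k /= gs // -[in LHS](hs z) ?hK // inE zs orbT.
have k's z : z \in s -> k' z = z by move=> zs; rewrite -[in LHS](ks z) ?kK.
pose w := k' y.
have kw : k w = y by exact: k'K.
have [||l [Gl ls lx]] := m (w :: s); rewrite ?inE ?negb_or ?xs ?ys ?andbT.
- apply: contraNneq y'y => xw.
  by exfalso; move: kw; rewrite -xw kx => xy; move: y'x; rewrite -[in X in X != _]xy gx xy eqxx.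
- by apply: contraNneq y'y => yw; rewrite -ky {1}yw kw.
(* [p] fixes [s] and [y], and sends [x] to [g y] *)
pose p := k \o l \o k'.
have k'x : k' x = x by rewrite -{1}kx kK.
have px : p x = g y by rewrite /p /= k'x lx ky.
have py : p y = y by rewrite /p /= ls ?mem_head.
exists (g' \o p); split.
- by apply: (Gc) => //; apply: (Gc) => //; exact: (Gc).
- move=> z zs /=; rewrite /p /= k's // ls ?inE ?zs ?orbT // ks //.
  by rewrite -[in LHS](gs z) // gK.
- by rewrite /= px gK.
- by rewrite /= py -{1}gx gK.
Qed.

Lemma adj_setT_sim x y : adj G setT x y <-> sim G x y.
Proof.
split=> [a|sxy]; last first.
  split => // s hs; apply: sim_same_type => //; apply/negP => /hs[].
    by rewrite eqxx.
  by rewrite eqxx.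
apply: closed_mem; last by move=> z; exists (swap x y z); exact: swapK.
move=> s; pose r := [seq z <- s | (z != x) && (z != y)].
have [||g [Gg gr gx gy]] := @adj_setT_swap x y r a; rewrite ?mem_filter ?eqxx ?andbF //.
exists g => // z zs; have [->|zx] := eqVneq z x; first by rewrite swapL.
have [->|zy] := eqVneq z y; first by rewrite swapR.
by rewrite swapD // gr // mem_filter zx zy.
Qed.

(** The elements of [G] that approximate [f] are built as products of
transpositions inside similarity classes, one transposition for each point. *)
Lemma sim_emb f : injective f -> (forall x, sim G x (f x)) -> emb G f.
Proof.
move=> fI fs s.
suff [g [Gg gs _]] : exists g, [/\ G g, {in s, g =1 f} & forall x, sim G x (g x)].
  by exists g.
elim: s => [|z s [g [Gg gs gsim]]].
  by exists id; split => //; [exact: G_id|move=> x; exact: sim_refl].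
have [zs|zs] := boolP (z \in s).
  by exists g; split => // x; rewrite inE => /orP[/eqP->|/gs//]; exact: gs.
have sw : sim G (g z) (f z) := sim_trans groupG (sim_sym (gsim z)) (fs z).
exists (swap (g z) (f z) \o g); split.
- exact: G_comp.
- move=> x; rewrite inE => /orP[/eqP->|xs] /=; first by rewrite swapL.
  have xz : x != z by apply: contraNneq zs => <-.
  rewrite swapD ?(inj_eq (G_inj groupG Gg)) // ?gs //.
  by rewrite (inj_eq fI).
- move=> x /=; have [gxz|n1] := eqVneq (g x) (g z).
    by rewrite gxz swapL; apply: sim_trans sw; rewrite // -gxz.
  have [gxz|n2] := eqVneq (g x) (f z); last by rewrite swapD.
  by rewrite gxz swapR; apply: (sim_trans groupG _ (sim_sym sw)) => //; rewrite -gxz.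
Qed.

(** * Finitely many similarity classes: every sibling is a copy *)

Definition finitely_many_classes := exists s : seq E, forall t, exists2 x, x \in s & sim G t x.

(** Two iterates of [x] are similar by the pigeonhole principle, and embeddings
reflect similarity. *)
Lemma iter_returns f x : finitely_many_classes -> emb G f ->
  exists k, (0 < k)%N /\ sim G (iter k f x) x.
Proof.
move=> [s /(_ _)/cid2-/all_sig[r rP]] ef.
have rs t : r t \in s by case: (rP t).
have rS t : sim G t (r t) by case: (rP t).
pose l := [seq r (iter i f x) | i <- iota 0 (size s).+1].
have : ~~ uniq l.
  apply/negP => ul.
  have : (size l <= size s)%N.
    by apply: uniq_leq_size ul _ => _ /mapP[i _ ->].
  by rewrite size_map size_iota ltnn.
move=> /(uniqPn x)[i [j [ij jl]]].
rewrite size_map size_iota in jl.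
rewrite !(nth_map 0%N) ?size_iota // ?(ltn_trans ij jl) // !nth_iota ?(ltn_trans ij) //.
rewrite !add0n => rij; exists (j - i)%N; split; first by rewrite subn_gt0.
apply: (emb_sim groupG _ _ (emb_iter groupG i ef)).2; rewrite -iterD subnKC; last exact: ltnW.
by apply: (sim_trans groupG (rS _)); rewrite -rij; apply: sim_sym.
Qed.

(** Iterating [f] on each class until it returns yields an injection [F] of [E] into
[S] preserving each class.  The Cantor-Bernstein bijection between [E] and [S]
built from [F] and the inclusion moves each point [x] to [x] or [F x], so it also
preserves each class and is therefore a local embedding. *)
Lemma sibling_is_copy f (S : set E) :
  finitely_many_classes -> emb G f -> (forall x, S (f x)) ->
  exists2 h, emb G h & h @` setT = S.
Proof.
move=> fc ef Sf.
pose K x := [set k | (0 < k)%N /\ sim G (iter k f x) x].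
have Ksim x y : sim G x y -> K x = K y.
  move=> sxy; apply/seteqP; split => k [k0 kx]; split => //.
    apply: (sim_trans groupG _ sxy); apply: (sim_trans groupG _ kx).
    apply: (emb_sim groupG _ _ (emb_iter groupG k ef)).1; exact: sim_sym.
  apply: (sim_trans groupG _ (sim_sym sxy)); apply: (sim_trans groupG _ kx).
  exact: (emb_sim groupG _ _ (emb_iter groupG k ef)).1.
(* choosing [k x] from the set [K x] makes it constant on classes *)
pose k x := xget 1%N (K x).
have kP x : K x (k x).
  by apply: (@xgetPex _ 1%N (K x)); exact: iter_returns.
pose F x := iter (k x) f x.
have FS x : sim G x (F x) by apply: sim_sym; case: (kP x).
have SF x : S (F x).
  by rewrite /F; case: (kP x) => + _; case: (k x) => //= n _; exact: Sf.
have FI : injective F.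
  move=> x y Fxy; have sxy : sim G x y.
    by apply: (sim_trans groupG (FS x)); rewrite Fxy; exact: sim_sym.
  move: Fxy; rewrite /F /k (Ksim _ _ sxy).
  exact: (emb_inj groupG (emb_iter groupG _ ef)).
(* the points whose backward [F]-orbit starts outside [S] *)
pose D := [set z | exists n y, ~ S y /\ z = iter n F y].
pose h z := if `[< D z >] then F z else z.
have hD z : D z -> h z = F z by move=> Dz; rewrite /h asboolT.
have hN z : ~ D z -> h z = z by move=> Dz; rewrite /h asboolF.
have DF z : D z -> D (F z) by move=> [n [y [Sy ->]]]; exists n.+1, y.
have DS z : ~ S z -> D z by move=> Sz; exists 0%N, z.
exists h.
  apply: sim_emb => [x y|x].
    have [Dx|Dx] := pselect (D x); have [Dy|Dy] := pselect (D y).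
    - by rewrite !hD // => /FI.
    - by rewrite hD // hN // => xy; case: Dy; rewrite -xy; exact: DF.
    - by rewrite hN // hD // => xy; case: Dx; rewrite xy; exact: DF.
    - by rewrite !hN.
  have [Dx|Dx] := pselect (D x); first by rewrite hD.
  by rewrite hN //; exact: sim_refl.
apply/seteqP; split => [_ [x _ <-]|z Sz].
  have [Dx|Dx] := pselect (D x); first by rewrite hD.
  by rewrite hN //; apply: contrapT => /DS.
have [[[|n] [y [Sy zE]]]|Dz] := pselect (D z); last by exists z; rewrite // hN.
  by exfalso; apply: Sy; rewrite zE in Sz.
by exists (iter n F y) => //; rewrite hD //; exists n, y.
Qed.

End Closed.

(** * Consequences of oligomorphy *)

Section Oligo.
Context (E : choiceType) (G : set (E -> E)).
Hypotheses (groupG : perm_group G) (oligoG : oligomorphic G).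

Lemma card_uniq (s : seq E) : uniq s -> [set` s] #= `I_(size s).
Proof.
move=> us; have -> : [set` s] = [set` [fset x in s]%fset].
  by apply/seteqP; split => x; rewrite /= inE.
by apply/card_eq_fsetP; rewrite card_fseq undup_id.
Qed.

(** A bound that exists for each [n]-element set and is invariant under [G] is
uniform, since it only has to be taken over finitely many orbits. *)
Lemma oligomorphic_bound n (Q : set E -> nat -> Prop) :
  (forall A k l, (k <= l)%N -> Q A k -> Q A l) ->
  (forall g A k, G g -> Q A k -> Q (g @` A) k) ->
  (forall A, A #= `I_n -> exists k, Q A k) ->
  exists k, forall A, A #= `I_n -> Q A k.
Proof.
move=> QW QG Qex; have /finite_seqP[os osE] := oligoG n.
suff [k kP] : exists k, forall o, o \in os -> forall A, o A -> Q A k.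
  exists k => A An; apply: (kP (orbit_of G A)).
    have : [set` os] (orbit_of G A) by rewrite -osE; exists A.
    by [].
  by exists id; [exact: G_id|rewrite image_id].
have : forall o, o \in os -> exists k, forall A, o A -> Q A k.
  move=> o oos; have [A An <-] : (orbit_of G @` [set A | A #= `I_n]) o by rewrite osE.
  by have [k Qk] := Qex _ An; exists k => _ [g Gg ->]; exact: QG.
elim: os {osE} => [|o os IHos] h; first by exists 0%N.
have [|k kP] := IHos; first by move=> p pos; apply: h; rewrite inE pos orbT.
have [l lP] := h o (mem_head _ _); exists (maxn k l) => p.
rewrite inE => /orP[/eqP->|pos] A pA.
  exact: (QW _ _ _ (leq_maxr _ _) (lP _ pA)).
exact: (QW _ _ _ (leq_maxl _ _) (kP _ pos _ pA)).
Qed.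

Lemma class_bound : exists m, forall x, (exists k, small k (sim G x)) ->
  small m (sim G x).
Proof.
pose Q (A : set E) m := forall x, A x -> (exists k, small k (sim G x)) ->
  small m (sim G x).
have [|||m mP] := @oligomorphic_bound 1 Q.
- by move=> A k l kl QA x Ax /(QA _ Ax); exact: leq_small.
- move=> g A k Gg QA _ [x Ax <-] [l sl].
  have gi := G_inj groupG Gg; have [h [Gh gK hK]] := G_inv groupG Gg.
  have /(small_image g) : small k (sim G x).
    apply: QA => //; exists l; apply: small_preimage gi _ sl => y.
    exact: (sim_move groupG x y Gg).1.
  apply: sub_small => y sy; exists (h y); last exact: hK.
  by apply: (sim_move groupG x (h y) Gg).2; rewrite hK.
- move=> A /eq_cardSP[x Ax]; rewrite II0 card_eq0 => /eqP A0.
  have AE y : A y -> y = x.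
    by move=> Ay; apply: contrapT => yx; suff : set0 y by []; rewrite -A0; split.
  have [[k sk]|n] := pselect (exists k, small k (sim G x)).
    by exists k => y /AE->.
  by exists 0%N => y /AE->.
- by exists m => x; apply: (mP [set x]) => //; exact: card_set1.
Qed.

(** Each pair of non-adjacent points is separated by a finite set; only finitely
many orbits of two-element sets are to be considered, and a set separating
[(x, y)] also separates [(y, x)]. *)
Lemma separation_bound : exists m, forall x y, ~ adj G setT x y ->
  exists s, [/\ (size s <= m)%N, x \notin s, y \notin s & ~ same_type G s x y].
Proof.
pose Q (A : set E) m := forall x y, A x -> A y -> ~ adj G setT x y ->
  exists s, [/\ (size s <= m)%N, x \notin s, y \notin s & ~ same_type G s x y].
have adjTN x y : ~ adj G setT x y ->
    exists s, [/\ x \notin s, y \notin s & ~ same_type G s x y].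
  apply: contra_notP => n; split => // s hs; apply: contrapT => m; apply: n.
  by exists s; split => //; apply/negP => /hs[]; rewrite eqxx.
have [|||m mP] := @oligomorphic_bound 2 Q.
- move=> A k l kl QA x y Ax Ay /(QA _ _ Ax Ay)[s [sk xs ys ms]].
  by exists s; split => //; exact: leq_trans kl.
- move=> g A k Gg QA _ _ [x Ax <-] [y Ay <-] n.
  have gi := G_inj groupG Gg; have [h [Gh gK hK]] := G_inv groupG Gg.
  have conj s u v : same_type G s u v -> same_type G (map g s) (g u) (g v).
    move=> [p [Gp ps pu]]; exists (g \o p \o h); split.
    + by apply: G_comp => //; exact: G_comp.
    + by move=> _ /mapP[z zs ->] /=; rewrite gK ps.
    + by rewrite /= gK pu.
  have conjV s u v : same_type G (map g s) (g u) (g v) -> same_type G s u v.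
    move=> [p [Gp ps pu]]; exists (h \o p \o g); split.
    + by apply: G_comp => //; exact: G_comp.
    + by move=> z zs /=; rewrite ps ?map_f ?gK.
    + by rewrite /= pu gK.
  have [|s [sk xs ys ms]] := QA x y Ax Ay.
    apply: contra_not n => -[_ _ a]; split => // s hs.
    have sE : map g (map h s) = s by rewrite -map_comp map_id_in // => z _ /=.
    rewrite -sE; apply: conj; apply: a => z /mapP[w /hs[_ wx wy] ->].
    by split => //; rewrite -(inj_eq gi) hK.
  exists (map g s); rewrite size_map !mem_map //; split => //.
  by apply: contra_not ms; exact: conjV.
- move=> A /eq_cardSP[x Ax] /eq_cardSP[y [Ay yx]]; rewrite II0 card_eq0 => /eqP A0.
  have AE z : A z -> z = x \/ z = y.
    move=> Az; apply: contrapT => /not_orP[zx zy].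
    by suff : set0 z by []; rewrite -A0; split; first by split.
  have [k kP] : exists k, forall u v, A u -> A v -> u != v ->
     ~ adj G setT u v ->
     exists s, [/\ (size s <= k)%N, u \notin s, v \notin s & ~ same_type G s u v].
    have [a|n] := pselect (adj G setT x y).
      exists 0%N => u v /AE[]-> /AE[]->; rewrite ?eqxx // => _ [] //.
      exact: adj_sym.
    have [s [xs ys ms]] := adjTN _ _ n; exists (size s) => u v uA vA uv n'.
    exists s; move: uv; case: (AE _ uA) => ->; case: (AE _ vA) => ->; rewrite ?eqxx //.
    by move=> _; split => // /(same_type_sym groupG).
  exists k => u v Au Av nuv; apply: kP => //; apply/negP => /eqP uv.
  by apply: nuv; rewrite uv; split => // s _; exact: same_type_refl.
- exists m => x y nxy; apply: (mP [set` [:: x; y]]) => //=; rewrite ?inE ?eqxx ?orbT //.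
  have [xy|xy] := eqVneq x y.
    by exfalso; apply: nxy; rewrite xy; split => // s _; exact: same_type_refl.
  by apply: (@card_uniq [:: x; y]); rewrite /= inE xy.
Qed.

Context (U : set_system E) (UU : UltraFilter U).

Lemma ultra_pigeonhole (Y : eqType) (f : E -> Y) (c : seq Y) :
  U [set t | f t \in c] -> exists y, U [set t | f t = y].
Proof.
have UF := @ultra_proper _ _ UU.
elim: c => [|y c IHc] Uc.
  exfalso; apply: (@filter_not_empty _ U); apply: filterS Uc => t /=.
  by rewrite in_nil.
have [Uy|Uy] := in_ultra_setVsetC [set t | f t = y] UU; first by exists y.
apply: IHc; apply: filterS (filterI Uc Uy) => t [/=]; rewrite inE.
by move=> /orP[/eqP|].
Qed.

Lemma ultra_all (s : seq E) (P : E -> set E) :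
  (forall z, z \in s -> U (P z)) -> U [set t | forall z, z \in s -> P z t].
Proof.
have UF := @ultra_proper _ _ UU.
elim: s => [|z s IHs] h; first by apply: filterS filterT => t _.
have /IHs Us : forall w, w \in s -> U (P w).
  by move=> w ws; apply: h; rewrite inE ws orbT.
apply: filterS (filterI (h z (mem_head _ _)) Us) => t [Pz Ps] w.
by rewrite inE => /orP[/eqP->|/Ps].
Qed.

(** Oligomorphy speaks of orbits of sets, whereas types are orbits of tuples.  For
almost all [t] the set [f t :: s] lies in one fixed orbit, hence is carried to
one finite set [f t0 :: s]; by the pigeonhole principle the images of [f t] and of
each point of [s] under the chosen element of [G] are also almost constant. *)
Lemma ultra_type (f : E -> E) (s : seq E) : (forall x, U [set t | f t != x]) ->
  exists c, U [set t | same_type G s (f t) c].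
Proof.
move=> fU; have UF := @ultra_proper _ _ UU.
wlog us : s / uniq s => [wl|].
  have [c cP] := wl _ (undup_uniq s); exists c; apply: filterS cP => t.
  by apply: same_type_sub => z; rewrite mem_undup.
have Uns : U [set t | f t \notin s].
  have := @ultra_all s (fun z => [set t | f t != z]) (fun z _ => fU z).
  by apply: filterS => t h; apply/negP => /h; rewrite /= eqxx.
have /finite_seqP[os osE] := oligoG (size s).+1.
pose orb t := orbit_of G [set` f t :: s].
have [o oP] : exists o, U [set t | orb t = o].
  apply: (@ultra_pigeonhole _ orb os); apply: filterS Uns => t ns.
  have : [set` os] (orb t); last by [].
  rewrite -osE; exists [set` f t :: s] => //.
  by apply: (@card_uniq (f t :: s)); rewrite /= ns.
have [t0 ot0] := filter_ex oP.
have /choice[g gP] : forall t, exists g, orb t = o ->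
    G g /\ g @` [set` f t :: s] = [set` f t0 :: s].
  move=> t; have [ot|] := pselect (orb t = o); last by exists id.
  have [g Gg gE] : orb t [set` f t0 :: s].
    by rewrite ot -ot0; exists id; [exact: G_id|rewrite image_id].
  by exists g.
have gv (k : E -> E) : (forall t, k t \in f t :: s) ->
    exists v, U [set t | g t (k t) = v].
  move=> kP; apply: (@ultra_pigeonhole _ (fun t => g t (k t)) (f t0 :: s)).
  apply: filterS oP => t /gP[Gg gE] /=.
  by have : [set` f t0 :: s] (g t (k t)) by rewrite -gE; exists (k t) => //; exact: kP.
have [v vP] := gv f (fun t => mem_head _ _).
have /choice[w wP] : forall z, exists w, z \in s -> U [set t | g t z = w].
  move=> z; have [zs|] := boolP (z \in s); last by exists z.
  by have [|w wP] := gv (fun=> z); [move=> t; rewrite inE zs orbT|exists w].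
have Uall : U [set t | [/\ orb t = o, g t (f t) = v &
    forall z, z \in s -> g t z = w z]].
  by apply: filterS (filterI oP (filterI vP (ultra_all wP))) => t [? []].
have [t1 [/gP[Gg1 _] v1 w1]] := filter_ex Uall.
exists (f t1); apply: filterS Uall => t [/gP[Gg _] vt wt].
have [h [Gh gK hK]] := G_inv groupG Gg1; exists (h \o g t); split.
- exact: G_comp.
- by move=> z zs /=; rewrite wt // -w1 // gK.
- by rewrite /= vt -v1 gK.
Qed.

End Oligo.

(** * Embeddings built along an exhaustion of a countable set *)

Section Count.
Context (E : choiceType) (G : set (E -> E)).
Hypotheses (groupG : perm_group G) (countE : countable [set: E]).

Lemma finite_exhaustion : exists b : nat -> seq E,
  [/\ b 0%N = [::], forall n, {subset b n <= b n.+1} &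
      forall s : seq E, exists n, {subset s <= b n}].
Proof.
have /countable_injP[idx idxI] := countE.
pose e n := xget [::] [set s : seq E | exists x, s = [:: x] /\ idx x = n].
pose b := fix b n := if n is n.+1 then b n ++ e n else [::].
have bS n : {subset b n <= b n.+1} by move=> x xn; rewrite mem_cat xn.
have bL n m : (n <= m)%N -> {subset b n <= b m}.
  elim: m => [|m IHm]; first by rewrite leqn0 => /eqP->.
  rewrite leq_eqVlt => /orP[/eqP->//|]; rewrite ltnS => /IHm h x /h; exact: bS.
have bx x : x \in b (idx x).+1.
  rewrite mem_cat /e.
  have : [set s : seq E | exists y, s = [:: y] /\ idx y = idx x] [:: x] by exists x.
  move=> /xgetI => /(_ [::])[y [-> /idxI]]; rewrite !in_setT => <- //.
  by rewrite mem_head orbT.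
exists b; split => //; elim=> [|x s [n sn]]; first by exists 0%N.
exists (maxn n (idx x).+1) => y; rewrite inE => /orP[/eqP->|/sn].
  exact: (bL _ _ (leq_maxr _ _)).
exact: (bL _ _ (leq_maxl _ _)).
Qed.

Lemma glue_sequence (b : nat -> seq E) (Q : nat -> (E -> E) -> Prop) :
  (forall n, {subset b n <= b n.+1}) ->
  (forall s : seq E, exists n, {subset s <= b n}) ->
  (exists g, Q 0%N g) ->
  (forall n g, Q n g -> exists g', Q n.+1 g' /\ {in b n, g' =1 g}) ->
  exists h, forall n, exists g, Q n g /\ {in b n, g =1 h}.
Proof.
move=> bS bT [g0 Q0] step.
have /choice[st stP] : forall p : nat * (E -> E), exists g',
    Q p.1 p.2 -> Q p.1.+1 g' /\ {in b p.1, g' =1 p.2}.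
  move=> [n g] /=; have [Qg|] := pselect (Q n g); last by exists g.
  by have [g' ?] := step _ _ Qg; exists g'.
pose gs := fix gs n := if n is n.+1 then st (n, gs n) else g0.
have gsQ n : Q n (gs n) by elim: n => //= n /(stP (n, gs n))[].
have gsS n : {in b n, gs n.+1 =1 gs n} by have [] := stP (n, gs n) (gsQ n).
have gsL n m : (n <= m)%N -> {in b n, gs m =1 gs n}.
  elim: m => [|m IHm]; first by rewrite leqn0 => /eqP->.
  rewrite leq_eqVlt => /orP[/eqP->//|]; rewrite ltnS => nm x xn.
  rewrite gsS ?IHm //; elim: m nm {IHm} => [|m IHm]; first by rewrite leqn0 => /eqP<-.
  rewrite leq_eqVlt => /orP[/eqP<-//|]; rewrite ltnS => nm; apply: bS; exact: IHm.
have /choice[ix ixP] : forall x, exists n, x \in b n.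
  by move=> x; have [n xn] := bT [:: x]; exists n; apply: xn; rewrite mem_head.
exists (fun x => gs (ix x) x) => n; exists (gs n); split => // x xn.
by have [l|/ltnW l] := leqP n (ix x); [rewrite (gsL _ _ l)|rewrite (gsL _ _ l)].
Qed.

Lemma emb_of_sequence (b : nat -> seq E) (Q : nat -> (E -> E) -> Prop) h :
  (forall s : seq E, exists n, {subset s <= b n}) ->
  (forall n g, Q n g -> G g) ->
  (forall n, exists g, Q n g /\ {in b n, g =1 h}) -> emb G h.
Proof.
move=> bT QG hQ s; have [n sn] := bT s; have [g [/QG Gg gh]] := hQ n.
by exists g => // z /sn/gh.
Qed.

(** The embedding is constructed one point at a time; the hypothesis allows the
next point to be moved into [D] while the previous images stay fixed. *)
Lemma emb_avoid (D : set E) :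
  (forall (s : seq E) y, (forall z, z \in s -> D z) ->
     exists2 t, D t & same_type G s y t) ->
  exists f, emb G f /\ forall x, D (f x).
Proof.
move=> Dt; have [b [b0 bS bT]] := finite_exhaustion.
pose Q n g := G g /\ forall x, x \in b n -> D (g x).
have [||h hQ] := @glue_sequence b Q bS bT.
- by exists id; split; [exact: G_id|rewrite b0].
- move=> n g [Gg gD].
  suff [g' [Gg' g'g g'D]] : exists g', [/\ G g', {in b n, g' =1 g} &
      forall x, x \in b n.+1 -> D (g' x)] by exists g'.
  elim: (b n.+1) => [|x s [g' [Gg' g'g g'D]]]; first by exists g.
  have [|t Dt' [k [Gk ks kt]]] := Dt (map g' (b n ++ s)) (g' x).
    move=> _ /mapP[z + ->]; rewrite mem_cat => /orP[zb|/g'D//].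
    by rewrite g'g //; exact: gD.
  exists (k \o g'); split; first exact: G_comp.
    move=> z zb /=; have zl : z \in b n ++ s by rewrite mem_cat zb.
    by rewrite ks ?map_f // g'g.
  move=> z; rewrite inE => /orP[/eqP->|zs] /=; first by rewrite kt.
  have zl : z \in b n ++ s by rewrite mem_cat zs orbT.
  by rewrite ks ?map_f //; exact: g'D.
exists h; split; first by apply: emb_of_sequence bT _ hQ => n g [].
move=> x; have [n xn] := bT [:: x]; have [g [[_ gD] gh]] := hQ n.
have xb : x \in b n by apply: xn; exact: mem_head.
by rewrite -gh //; exact: gD.
Qed.

(** The ultrafilter prescribes, for each finite part [b n] of [E], the type over
[b n] of the generic point [f t], represented by a point [c n].  These types are
compatible with each other but need not be realised by one point of [E]; instead
[c 0] is kept fixed, and the parameters are moved to [h (b n)] so that [c 0] has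
over them the type of [c n] over [b n]. *)
Lemma limit_point (U : set_system E) (f : E -> E) :
  oligomorphic G -> UltraFilter U -> (forall x, U [set t | f t != x]) ->
  exists h a, emb G h /\ forall s : seq E,
    U [set t | exists g, [/\ G g, {in s, g =1 h} & g (f t) = a]].
Proof.
move=> oligoG UU fU; have UF := @ultra_proper _ _ UU.
have [b [b0 bS bT]] := finite_exhaustion.
have /choice[c cP] : forall n, exists c, U [set t | same_type G (b n) (f t) c].
  by move=> n; exact: ultra_type.
pose Q n g := G g /\ g (c n) = c 0%N.
have [||h hQ] := @glue_sequence b Q bS bT.
- by exists id; split => //; exact: G_id.
- move=> n g [Gg gc].
  have [t [m0 m1]] := filter_ex (filterI (cP n) (cP n.+1)).
  have [k [Gk ks kc]] : same_type G (b n) (c n.+1) (c n).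
    apply: (same_type_trans groupG) m0; apply: (same_type_sym groupG).
    by apply: same_type_sub m1; exact: bS.
  exists (g \o k); split; first by split; [exact: G_comp|rewrite /= kc].
  by move=> z zb /=; rewrite ks.
exists h, (c 0%N); split; first by apply: emb_of_sequence bT _ hQ => n g [].
move=> s; have [n sn] := bT s; have [g [[Gg gc] gh]] := hQ n.
apply: filterS (cP n) => t [k [Gk ks kt]]; exists (g \o k); split.
- exact: G_comp.
- by move=> z /sn zb /=; rewrite ks // gh.
- by rewrite /= kt.
Qed.

End Count.

(** * Infinitely many similarity classes *)

Section Infinite.
Context (E : choiceType) (G : set (E -> E)).
Hypotheses (groupG : perm_group G) (closedG : closed_group G)
  (oligoG : oligomorphic G) (countE : countable [set: E]).

Lemma generic_ultrafilter : ~ finitely_many_classes G ->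
  exists U : set_system E, UltraFilter U /\ forall x, U [set t | ~ sim G t x].
Proof.
move=> inf.
pose F := [set A : set E | exists s : seq E,
  forall t, ~ A t -> exists2 x, x \in s & sim G t x].
have FF : ProperFilter F.
  split.
    move=> [s sP]; apply: inf; exists s => t; exact: sP.
  split.
  - by exists [::] => t; case.
  - move=> A B [s sP] [r rP]; exists (s ++ r) => t /not_andP[/sP|/rP] [x xs tx];
      by exists x; rewrite // mem_cat xs ?orbT.
  - by move=> A B AB [s sP]; exists s => t Bt; apply: sP => /AB.
have [U [UU FU]] := ultraFilterLemma FF.
exists U; split => // x; apply: FU; exists [:: x] => t /contrapT tx.
by exists x; rewrite // mem_head.
Qed.

Definition sibling (S : set E) := exists f, emb G f /\ forall x, S (f x).

(** The points of the class of [K] are interchangeable, so a set separating two points of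
[S] can be moved into [S] by transpositions inside the class of [K], provided
that [n] exceeds the size of the set by at least two.  So adjacency in [S] is still
similarity, and the [n] remaining points of the class form a component. *)
Lemma sibling_trimmed_class K m n f : (forall k, ~ small k (sim G K)) ->
  (forall x y, ~ adj G setT x y ->
  exists s, [/\ (size s <= m)%N, x \notin s, y \notin s & ~ same_type G s x y]) ->
  (forall c, (exists k, small k (sim G c)) -> small m (sim G c)) ->
  emb G f -> (forall x, ~ sim G K (f x)) -> (m.+1 < n)%N ->
  exists S, [/\ sibling S, big_component G n S &
    forall n', big_component G n' S -> (n' <= n + m)%N].
Proof.
move=> infK sepm clm ef fK mn.
have [r [ur rn rK]] : large n (sim G K).
  by apply: large_infinite => -[k]; exact: infK.
pose S := [set z | ~ sim G K z \/ z \in r].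
have Sout z : ~ S z -> sim G K z /\ z \notin r.
  by move=> /not_orP[/contrapT Kz /negP zr].
have push x y s : S x -> S y -> (size s <= m)%N ->
    exists g, [/\ G g, g x = x, g y = y & forall z, z \in s -> S (g z)].
  move=> Sx Sy; elim: s => [|z s IHs] sm.
    by exists id; split => //; exact: G_id.
  have [g [Gg gx gy gs]] := IHs (ltnW sm).
  have [Sz|/Sout[Kz zr]] := pselect (S (g z)).
    by exists g; split => // w; rewrite inE => /orP[/eqP->|/gs].
  (* [n > m + 1] leaves room for a point of [r] that is not yet in use *)
  have [w wr wn] : exists2 w, w \in r & w \notin [:: x, y & map g s].
    apply: contrapT => nw.
    have : (size r <= size [:: x, y & map g s])%N.
      apply: uniq_leq_size => // w wr; apply: contrapT => /negP wn.
      by apply: nw; exists w.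
    by rewrite rn /= size_map leqNgt (leq_trans _ mn) //= !ltnS.
  have SN u : S u -> u != g z.
    by apply: contraPneq => -> [/(_ Kz)//|gzr]; rewrite gzr in zr.
  move: wn; rewrite !inE !negb_or => /and3P[wx wy ws].
  exists (swap (g z) w \o g); split.
  - apply: G_comp => //; apply: sim_trans (rK _ wr) => //; exact: sim_sym.
  - by rewrite /= gx swapD ?SN // eq_sym.
  - by rewrite /= gy swapD ?SN // eq_sym.
  - move=> u; rewrite inE => /orP[/eqP->|us] /=; first by rewrite swapL; right.
    rewrite swapD ?SN //; try exact: gs.
    by apply: contraNneq ws => <-; exact: map_f.
have adjS u v : adj G S u v -> sim G u v.
  move=> [Su Sv a]; apply/(adj_setT_sim groupG closedG); apply: contrapT => n'.
  have [s [sm us vs ms]] := sepm _ _ n'; apply: ms.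
  have [g [Gg gu gv gs]] := push u v s Su Sv sm.
  have [h [Gh gK hK]] := G_inv groupG Gg; have gI := G_inj groupG Gg.
  have [|k [Gk ks ku]] := a (map g s).
    move=> _ /mapP[z zs ->]; split; first exact: gs.
    - by rewrite -gu (inj_eq gI); apply: contraNneq us => <-.
    - by rewrite -gv (inj_eq gI); apply: contraNneq vs => <-.
  exists (h \o k \o g); split.
  - by apply: G_comp => //; exact: G_comp.
  - by move=> z zs /=; rewrite ks ?map_f ?gK.
  - by rewrite /= gu ku -gv gK.
have simS u v : S u -> S v -> sim G u v -> adj G S u v.
  move=> Su Sv /(adj_setT_sim groupG closedG)[_ _ a]; split => // s hs.
  by apply: a => z /hs[].
have compS u v : S u -> component G S u v -> sim G u v /\ S v.
  move=> Su c; pose W := [set w | sim G u w /\ S w].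
  apply: (c W); first by split => //; exact: sim_refl.
  move=> p q [up Sp] /[dup] -[_ Sq _] /adjS pq; split => //.
  exact: (sim_trans groupG up).
have rS x : x \in r -> S x by move=> xr; right.
have simK x y : x \in r -> sim G x y -> S y -> y \in r.
  move=> xr xy [Ky|//]; exfalso; apply: Ky.
  exact: (sim_trans groupG (rK _ xr)).
have smallr x : x \in r -> small n (component G S x).
  move=> xr; exists r; first by rewrite rn.
  by move=> y /(compS _ _ (rS _ xr))[xy]; exact: simK xy.
exists S; split.
- by exists f; split => // x; left.
- have [x xr] : exists x, x \in r.
    by case: (r) rn mn => [<-//|x r' _ _]; exists x; exact: mem_head.
  exists x; split; [exact: rS|by exists n; exact: smallr|].
  exists r; split => // y yr; apply: (component_step (@component_refl _ _ _ _)).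
  apply: simS; [exact: rS|exact: rS|].
  by apply: (sim_trans groupG (sim_sym (rK _ xr))); exact: rK.
- move=> n' [x [Sx [k sk] lx]].
  suff sx : small (n + m) (component G S x) by exact: small_large sx lx.
  have [xr|xr] := boolP (x \in r).
    exact: leq_small (leq_addr _ _) (smallr _ xr).
  have nKx : ~ sim G K x by case: Sx => // xr'; rewrite xr' in xr.
  apply: leq_small (leq_addl n m) _; apply: (@sub_small _ _ _ (sim G x)).
    by move=> y /(compS _ _ Sx)[].
  apply: clm; exists k; apply: sub_small sk => y xy.
  apply: (component_step (@component_refl _ _ _ _)); apply: simS => //; left.
  by move=> Ky; apply: nKx; apply: (sim_trans groupG Ky); exact: sim_sym.
Qed.

(** * Generic points and towers of limits *)

Section Tower.
Context (U : set_system E) (UU : UltraFilter U).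
Hypothesis Usim : forall x, U [set t | ~ sim G t x].

Lemma generic_neq x : U [set t | t != x].
Proof.
have UF := @ultra_proper _ _ UU.
apply: filterS (Usim x) => t; apply: contra_notN => /eqP->; exact: sim_refl.
Qed.

Lemma generic_emb_neq f x : emb G f -> U [set t | f t != x].
Proof.
have UF := @ultra_proper _ _ UU => ef.
have [[y <-]|n] := pselect (exists y, f y = x).
  by apply: filterS (generic_neq y) => t; rewrite /= (inj_eq (emb_inj groupG ef)).
by apply: filterS filterT => t _; apply/negP => /eqP fx; apply: n; exists t.
Qed.

(** These are the only points of [E] that can become adjacent to a generic point
adjoined to [E]. *)
Definition is_limit x := forall s : seq E, x \notin s -> U [set t | same_type G s t x].

Lemma is_limit_sim x y : is_limit x -> sim G x y -> is_limit y.
Proof.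
have UF := @ultra_proper _ _ UU; move=> Lx xy s ys.
have nx : x \notin map (swap x y) s.
  apply/mapP => -[z zs xz]; move: ys.
  by rewrite -[y](swapL x y) [X in swap x y X]xz swapK zs.
apply: filterS (filterI (Lx _ nx) (filterI (generic_neq x) (generic_neq y))).
move=> t [[g [Gg gs gt]] [tx ty]]; exists (swap x y \o g \o swap x y); split.
- by apply: G_comp => //; exact: G_comp.
- by move=> z zs /=; rewrite gs ?swapK ?map_f.
- by rewrite /= (swapD tx ty) gt swapL.
Qed.

(** Two limit points have the type of one generic point, so they are adjacent. *)
Lemma is_limit_unique x y : is_limit x -> is_limit y -> sim G x y.
Proof.
have UF := @ultra_proper _ _ UU; move=> Lx Ly.
apply/(adj_setT_sim groupG closedG); split => // s hs.
have xs : x \notin s by apply/negP => /hs[]; rewrite eqxx.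
have ys : y \notin s by apply/negP => /hs[]; rewrite eqxx.
have [t [mx my]] := filter_ex (filterI (Lx _ xs) (Ly _ ys)).
exact: (same_type_trans groupG (same_type_sym groupG mx)).
Qed.

(** By similarity every point of the class of [K] is a limit, so it can be replaced
with a generic point, which almost surely lies outside the class. *)
Lemma limit_avoid K :
  is_limit K -> exists f, emb G f /\ forall x, ~ sim G K (f x).
Proof.
have UF := @ultra_proper _ _ UU; move=> LK.
apply: (emb_avoid groupG countE (D := [set x | ~ sim G K x])) => s y sK.
have [Ky|nKy] := pselect (sim G K y); last by exists y => //; exact: same_type_refl.
have ys : y \notin s by apply/negP => /sK.
have [t [tK ty]] := filter_ex (filterI (Usim K) (is_limit_sim LK Ky ys)).
by exists t; [move=> Kt; apply: tK; exact: sim_sym|exact: same_type_sym].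
Qed.

Definition tower_set (f : E -> E) (A : seq E) := [set z | range f z \/ z \in A].

(** The most recent point [b] is generic over everything else in the tower; this is
what makes it adjacent to the point adjoined next. *)
Definition head_lim (f : E -> E) (A : seq E) :=
  if A is b :: _ then
    (forall s : seq E, (forall z, z \in s -> tower_set f A z /\ z != b) ->
       U [set t | same_type G s (f t) b]) /\
    (forall a, a \in A -> component G (tower_set f A) b a)
  else True.

(** A copy [f @` setT] of [E] with [n] further points [A], most recent first.
Similar points of [E] stay adjacent in the tower, and each point of [A] is
generic over the copy; [head_lim] gives the connectedness of [A]. *)
Definition tower n (f : E -> E) (A : seq E) :=
  [/\ emb G f, uniq A /\ size A = n,
      forall x y, sim G x y -> adj G (tower_set f A) (f x) (f y),
      forall a (s : seq E), a \in A ->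
        U [set t | exists g, [/\ G g, {in s, g =1 f} & g t = a]] &
      head_lim f A].

Lemma tower0 : tower 0 id [::].
Proof.
split => //; first exact: emb_G (G_id groupG).
have -> : tower_set id [::] = setT by apply/seteqP; split => // x _; left; exists x.
by move=> x y /(adj_setT_sim groupG closedG).
Qed.

(** The new tower is the image of the old one by [h], with the new point [a]: a
list of its points comes from a list of points of the old tower, up to [a]. *)
Lemma tower_set_preimage f A h a (P : set E) s :
  (forall z, z \in s -> tower_set (h \o f) (a :: map h A) z) ->
  (forall z, h z \in s -> P z) ->
  exists r, [/\ forall z, z \in r -> tower_set f A z /\ P z,
     {subset s <= a :: map h r} & (a \notin s -> s = map h r)].
Proof.
elim: s => [|z s IHs] es Ps; first by exists [::].
have [|w ws|r [rP sr asr]] := IHs.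
- by move=> w ws; apply: es; rewrite inE ws orbT.
- by apply: Ps; rewrite inE ws orbT.
have [za|[y ey zE]] : z = a \/ exists2 y, tower_set f A y & z = h y.
  case: (es z (mem_head _ _)) => [[x _ <-]|].
    by right; exists (f x) => //; left; exists x.
  rewrite inE => /orP[/eqP|/mapP[y yA ->]]; first by left.
  by right; exists y => //; right.
- exists r; rewrite za; split => //; last by rewrite mem_head.
  by move=> w; rewrite inE => /orP[/eqP->|/sr//]; exact: mem_head.
- exists (y :: r); split.
  + move=> w; rewrite inE => /orP[/eqP->|/rP//]; split => //.
    by apply: Ps; rewrite -zE mem_head.
  + move=> w; rewrite inE zE => /orP[/eqP->|/sr]; rewrite /= !inE ?eqxx ?orbT //.
    by move=> /orP[]->; rewrite ?orbT.
  + by rewrite inE negb_or => /andP[_ /asr->]; rewrite /= zE.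
Qed.

(** Adjoin a point [a] that is generic over the whole previous tower.  Adjacent points
of that tower stay adjacent, because they have the same type over each [f t], and
almost all [f t] look like [a].  The new point [a] and the previous head [b]
have the same type over the remaining points, both being generic over them. *)
Lemma tower_succ n f A : tower n f A -> exists f' A', tower n.+1 f' A'.
Proof.
have UF := @ultra_proper _ _ UU.
move=> [ef [uA sA] T3 T4 T5].
have fU x := generic_emb_neq x ef.
have [h [a [eh ha]]] := limit_point groupG countE oligoG UU fU.
have hI := emb_inj groupG eh.
pose A' := a :: map h A.
have anh x : a != h x.
  have [t [[g [Gg gx gt]] ftx]] := filter_ex (filterI (ha [:: x]) (fU x)).
  apply: contraNneq ftx => ax; apply/eqP/(G_inj groupG Gg).
  by rewrite gt ax gx // mem_head.
have extS z : tower_set f A z -> tower_set (h \o f) A' (h z).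
  move=> [[x _ <-]|zA]; first by left; exists x.
  by right; rewrite inE map_f ?orbT.
have adjh x y : adj G (tower_set f A) x y -> adj G (tower_set (h \o f) A') (h x) (h y).
  move=> [Sx Sy axy]; split; [exact: extS|exact: extS|move=> s hs].
  have [|z zs|r [rP sr _]] := @tower_set_preimage f A h a [set z | z != x /\ z != y] s.
  - by move=> z /hs[].
  - by have [_] := hs _ zs; rewrite !(inj_eq hI).
  have [t [[g [Gg gr gt]] [ftx fty]]] :=
    filter_ex (filterI (ha [:: x, y & r]) (filterI (fU x) (fU y))).
  have [|k [Gk kr kx]] := axy (f t :: r).
    move=> z; rewrite inE => /orP[/eqP->|/rP[? []]//]; split => //.
    by left; exists t.
  have [g' [Gg' gK g'K]] := G_inv groupG Gg.
  exists (g \o k \o g'); split.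
  - by apply: G_comp => //; exact: G_comp.
  - move=> z /sr; rewrite inE => /orP[/eqP->|/mapP[w wr ->]] /=.
      by rewrite -gt gK kr // mem_head.
    rewrite -(gr w) ?gK ?kr //; first by rewrite inE wr orbT.
    by rewrite !inE wr !orbT.
  - rewrite /= -(gr x) ?gK ?kx ?gr // !inE eqxx ?orbT //.
exists (h \o f), A'; split.
- exact: emb_comp.
- split; last by rewrite /= size_map sA.
  rewrite /= map_inj_uniq // uA andbT; apply/mapP => -[x _ /eqP].
  by rewrite (negPf (anh x)).
- by move=> x y /T3; exact: adjh.
- move=> a1 s; rewrite inE => /orP[/eqP->|/mapP[{}a1 a1A ->]].
    apply: filterS (ha (map f s)) => t [g [Gg gs gt]].
    have [k Gk ks] := ef (t :: s); exists (g \o k); split.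
    + exact: G_comp.
    + by move=> z zs /=; rewrite ks ?inE ?zs ?orbT // gs // map_f.
    + by rewrite /= ks ?mem_head.
  apply: filterS (T4 a1 s a1A) => t [g [Gg gs gt]].
  have [k Gk ks] := eh (a1 :: map f s); exists (k \o g); split.
  + exact: G_comp.
  + by move=> z zs /=; rewrite gs // ks // inE map_f // orbT.
  + by rewrite /= gt ks ?mem_head.
- split.
  + move=> s hs; have as_ : a \notin s by apply/negP => /hs[_]; rewrite eqxx.
    have [|//|r [_ _ /(_ as_) ->]] := @tower_set_preimage f A h a setT s.
      by move=> z /hs[].
    apply: filterS (ha r) => t [g [Gg gr gt]].
    have [k Gk kr] := eh (f t :: r); have [k' [Gk' kK k'K]] := G_inv groupG Gk.
    exists (g \o k'); split.
    * exact: G_comp.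
    * move=> _ /mapP[z zr ->] /=; rewrite -{1}kr ?kK ?gr //.
      by rewrite inE zr orbT.
    * by rewrite /= -kr ?mem_head ?kK.
  + case: A {T3 T4 sA uA} => [|b A] in A' T5 extS adjh *.
      by move=> c; rewrite inE => /eqP->; exact: component_refl.
    have [Lb cb] := T5; have Sb : tower_set f (b :: A) b by right; exact: mem_head.
    move=> c; rewrite inE => /orP[/eqP->|/mapP[{}c cA ->]]; first exact: component_refl.
    apply: (@component_trans _ _ _ _ (h b)); last first.
      pose W := [set z | tower_set f (b :: A) z /\ component G (tower_set (h \o f) A') (h b) (h z)].
      suff : W c by case.
      apply: (cb c cA W); first by split => //; exact: component_refl.
      move=> u v [_ cu] /[dup] -[_ Sv _] /adjh; split => //.
      exact: component_step cu _.
    apply: (component_step (@component_refl _ _ _ _)); split; [by right; exact: mem_head|exact: extS|].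
    move=> s hs; have as_ : a \notin s by apply/negP => /hs[_]; rewrite eqxx.
    have [|z zs|r [rP _ /(_ as_) ->]] := @tower_set_preimage f (b :: A) h a [set z | z != b] s.
    * by move=> z /hs[].
    * by have [_ _] := hs _ zs; rewrite (inj_eq hI).
    have [t [[g [Gg gr gt]] [k [Gk kr kt]]]] := filter_ex (filterI (ha r) (Lb r rP)).
    have [l Gl lr] := eh (b :: r); have [l' [Gl' lK l'K]] := G_inv groupG Gl.
    have [k' [Gk' kK k'K]] := G_inv groupG Gk.
    apply: (same_type_sym groupG); exists (g \o k' \o l'); split.
    * by apply: G_comp => //; exact: G_comp.
    * move=> _ /mapP[z zr ->] /=; rewrite -{1}lr ?inE ?zr ?orbT // lK.
      by rewrite -{1}(kr z zr) kK gr.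
    * by rewrite /= -lr ?mem_head // lK -kt kK.
Qed.

Lemma tower_exists n : exists f A, tower n f A.
Proof.
by elim: n => [|n [f [A /tower_succ//]]]; exists id, [::]; exact: tower0.
Qed.

(** The points [f y] adjacent to a point of [A] come from limits [y], which are all
similar, so the component of [A] has at most [n + m] points.  A component
meeting the copy in [f x] contains the image of the class of [x], so if it is
finite then this class has at most [m] points as well. *)
Lemma sibling_of_tower m n : (forall x, is_limit x -> small m (sim G x)) ->
  (forall x, (exists k, small k (sim G x)) -> small m (sim G x)) -> (0 < n)%N ->
  exists S, [/\ sibling S, big_component G n S &
    forall n', big_component G n' S -> (n' <= n + (m + m))%N].
Proof.
have UF := @ultra_proper _ _ UU.
move=> Lm clm n0; have [f [A [ef [uA sA] T3 T4 T5]]] := tower_exists n.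
pose S := tower_set f A; exists S.
have fI := emb_inj groupG ef.
have fS x : S (f x) by left; exists x.
have AS a : a \in A -> S a by right.
have An x : f x \notin A.
  apply/negP => /(T4 _ [:: x]) Ux.
  have [t [[g [Gg gs gt]] tx]] := filter_ex (filterI Ux (generic_neq x)).
  move: tx; rewrite /= -(inj_eq (G_inj groupG Gg)) gt gs ?mem_head //.
  by rewrite eqxx.
have adjA a y : a \in A -> adj G S a (f y) -> is_limit y.
  move=> aA [_ _ ay] s ys.
  have [|k [Gk ks ka]] := ay (map f s).
    move=> _ /mapP[z zs ->]; split => //.
      by apply: contraNneq (An z) => ->.
    by rewrite (inj_eq fI); apply: contraNneq ys => <-.
  have [l Gl ls] := ef (y :: s); have [l' [Gl' lK l'K]] := G_inv groupG Gl.
  apply: filterS (T4 a s aA) => t [g [Gg gs gt]].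
  exists (l' \o k \o g); split.
  - by apply: G_comp => //; exact: G_comp.
  - move=> z zs /=; rewrite gs // ks ?map_f // -ls ?lK //.
    by rewrite inE zs orbT.
  - by rewrite /= gt ka -ls ?lK // mem_head.
have adjf x y : adj G S (f x) (f y) -> sim G x y.
  move=> [_ _ a]; apply/(adj_setT_sim groupG closedG).
  apply: (loc_adj groupG ((embP G f).1 ef) (I : setT x) (I : setT y)).2.
  split; [by exists x|by exists y|move=> s hs; apply: a => z /hs[]].
  by case=> w _ <-; split.
pose L := [set y | exists x, is_limit x /\ sim G x y].
pose W := [set` A] `|` f @` L.
have Wcl u v : W u -> adj G S u v -> W v.
  move=> Wu a; have [_ [[y _ yv]|vA] _] := a; last by left.
  right; exists y => //; rewrite -yv in a.
  case: Wu => [uA'|[x [x0 [Lx0 x0x]] xu]].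
    by exists y; split; [exact: adjA a|exact: sim_refl].
  exists x0; split => //; rewrite -xu in a.
  exact: (sim_trans groupG x0x (adjf _ _ a)).
have WA : small n [set` A] by exists A => //; rewrite sA.
have Wsm : small (n + m) W.
  apply: smallU => //; apply: small_image.
  have [[x0 Lx0]|nL] := pselect (exists x, is_limit x).
    apply: sub_small (Lm _ Lx0) => y [x [Lx xy]].
    exact: (sim_trans groupG (is_limit_unique Lx0 Lx)).
  by exists [::] => // y [x [Lx _]]; exfalso; apply: nL; exists x.
have compA a : a \in A -> small (n + m) (component G S a).
  by move=> aA; apply: sub_small Wsm => y; apply => //; left.
split.
- by exists f.
- have [b bA cb] : exists2 b, b \in A & forall a, a \in A -> component G S b a.
    rewrite /S; case: (A) sA T5 => [sA|b A0 _ [_ cb]]; first by rewrite -sA in n0.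
    by exists b; first exact: mem_head.
  exists b; split; [exact: AS|by exists (n + m)%N; exact: compA|].
  by exists A.
- move=> n' [z [Sz [k sk] lz]]; rewrite addnA.
  suff sz : small (n + m + m) (component G S z) by exact: small_large sz lz.
  case: Sz => [[x _ xz]|zA]; last exact: leq_small (leq_addr _ _) (compA _ zA).
  have sx : small m (f @` sim G x).
    apply/small_image/clm; exists k; apply: small_preimage fI _ sk => y xy.
    by rewrite -xz; apply: (component_step (@component_refl _ _ _ _)); exact: T3.
  apply: sub_small (smallU Wsm sx) => y; rewrite -xz; apply.
    by right; exists x => //; exact: sim_refl.
  move=> u v [Wu|[w xw wu]] a; first by left; exact: Wcl a.
  have [_ [[w' _ w'v]|vA] _] := a; last by left; left.
  right; exists w' => //; rewrite -wu -w'v in a.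
  exact: (sim_trans groupG xw (adjf _ _ a)).
Qed.

End Tower.

(** The case distinction is whether some limit point has an infinite class. *)
Lemma siblings_large_components :
  ~ finitely_many_classes G -> exists c m, forall n, (c < n)%N ->
  exists S, [/\ sibling S, big_component G n S &
    forall n', big_component G n' S -> (n' <= n + m)%N].
Proof.
move=> inf; have [U [UU Usim]] := generic_ultrafilter inf.
have [m1 clm] := class_bound groupG oligoG.
have [m2 sepm] := separation_bound groupG oligoG.
have [[K [LK infK]]|nK] := pselect (exists K, is_limit U K /\ forall k, ~ small k (sim G K)).
  have [f [ef fK]] := limit_avoid UU Usim LK.
  exists (maxn m1 m2).+1, (maxn m1 m2) => n cn.
  apply: (sibling_trimmed_class infK _ _ ef fK cn).
    move=> x y /sepm[s [sm xs ys ms]]; exists s; split => //.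
    exact: leq_trans (leq_maxr _ _).
  by move=> x /clm; apply: leq_small; exact: leq_maxl.
exists 0%N, (m1 + m1)%N => n n0; apply: (sibling_of_tower UU Usim) => // x Lx.
apply: clm; apply: contrapT => nk; apply: nK; exists x; split => // k sk.
by apply: nk; exists k.
Qed.

End Infinite.

(** * Counting the classes of siblings *)

Section Classes.
Context (E : choiceType) (G : set (E -> E)).
Hypothesis groupG : perm_group G.

Lemma equivalentP (A B : set E) :
  equivalent G A B <-> exists f, local_embedding G A B f.
Proof.
split=> [[]//|[f fAB]]; split; first by exists f.
have [fA lf] := (local_embeddingP G A B f).1 fAB.
have [f' lf' fS] := loc_inverse groupG lf.
exists f'; rewrite -fA; exact/local_embeddingP.
Qed.

Lemma equivalent_refl (A : set E) : equivalent G A A.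
Proof.
apply/equivalentP; exists id; apply/local_embeddingP; split.
  exact: image_id.
exact: loc_id.
Qed.

Lemma equivalent_trans (A B C : set E) :
  equivalent G A B -> equivalent G B C -> equivalent G A C.
Proof.
move=> /equivalentP[f /local_embeddingP[fA lf]].
move=> /equivalentP[g /local_embeddingP[gB lg]].
apply/equivalentP; exists (g \o f); apply/local_embeddingP; split.
  by rewrite -image_comp fA gB.
by apply: loc_comp => //; rewrite fA.
Qed.

Lemma equivalent_sym (A B : set E) : equivalent G A B -> equivalent G B A.
Proof. by case. Qed.

Lemma equivalent_big_component (A B : set E) n :
  equivalent G A B -> big_component G n A -> big_component G n B.
Proof. by move=> /equivalentP[f /local_embeddingP[<- lf]]; exact: loc_big_component. Qed.

Lemma equivalence_class_copies : equivalence_class G setT = copies G.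
Proof.
apply/seteqP; split => [B /equivalentP[f /[dup] fB [fE _]]|_ [f [A fA] ->]].
  by exists f; rewrite ?fE //; exists B.
by apply/equivalentP; exists f; have [fE _] := fA; rewrite fE.
Qed.

Lemma siblingsP (S : set E) : siblings G S <-> sibling G S.
Proof.
split=> [[C [f [A /local_embeddingP[fA /embP ef]] ->] fS]|[f [ef fS]]].
  by exists f; split => // x; apply: fS; exists x.
exists (f @` setT); last by move=> _ [x _ <-].
by exists f => //; exists (f @` setT); apply/local_embeddingP; split => //; exact/embP.
Qed.

Lemma weak_classE : weak_class G setT = siblings G.
Proof.
apply/seteqP; split => [B [[f [C fC CB]] _]|B [C [f [A fA] CE] CB]].
  by exists C => //; exists f; [exists C|case: fC].
have [fAE lf] := (local_embeddingP G setT A f).1 fA.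
split; first by exists f, A => //; rewrite -fAE -CE.
exists id, B => //; apply/local_embeddingP; split; first exact: image_id.
exact: loc_id.
Qed.

Lemma weak_class_bigcup : weak_class G setT = \bigcup_(c in sib_classes G) c.
Proof.
rewrite weak_classE; apply/seteqP; split => [S sS|S [_ [R sR <-] RS]].
  by exists (equivalence_class G S); [exists S|exact: equivalent_refl].
have [f [ef fR]] := (siblingsP R).1 sR; apply/siblingsP.
have [g /local_embeddingP[gR lg]] := (equivalentP R S).1 RS.
exists (g \o f); split; last by move=> x /=; rewrite -gR; exists (f x).
apply/embP; apply: (loc_comp groupG ((embP G f).1 ef)).
move=> s sf; apply: lg => z /sf[x _ <-]; exact: fR.
Qed.

Hypotheses (closedG : closed_group G).

Lemma finite_classes_case : finitely_many_classes G ->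
  [/\ sib_classes G #= `I_1,
      weak_class G setT = equivalence_class G setT &
      exists P : set (set E),
        [/\ finite_set P, partition P id [set: E] &
            forall f : E -> E, bijective f ->
              (forall B, P B -> f @` B = B) -> G f]].
Proof.
move=> fc.
have sibT S : siblings G S -> equivalent G setT S.
  move=> /siblingsP[f [ef fS]].
  have [h /embP eh hS] := sibling_is_copy groupG fc ef fS.
  by apply/equivalentP; exists h; exact/local_embeddingP.
have Tsib : siblings G setT.
  by apply/siblingsP; exists id; split => //; exact: emb_G (G_id groupG).
split.
- have -> : sib_classes G = [set equivalence_class G setT].
    apply/seteqP; split => [_ [S /sibT TS <-]|_ ->]; last by exists setT.
    apply/seteqP; split => R; first exact: equivalent_trans.
    by apply: equivalent_trans; exact: equivalent_sym.
  exact: card_set1.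
- rewrite weak_classE; apply/seteqP; split => [S /sibT//|S].
  rewrite -weak_classE weak_class_bigcup => TS.
  by exists (equivalence_class G setT) => //; exists setT.
- have [s sP] := fc.
  exists [set sim G x | x in setT]; split.
  + apply: (@sub_finite_set _ _ [set sim G x | x in [set` s]]); last first.
      exact/finite_image/finite_seq.
    move=> _ [x _ <-]; have [y ys xy] := sP x; exists y => //.
    apply/seteqP; split => z; first exact: sim_trans.
    by apply: (sim_trans groupG); exact: sim_sym.
  + split.
    * by apply/seteqP; split => // x _; exists (sim G x); [exists x|exact: sim_refl].
    * move=> _ _ [x _ <-] [y _ <-] [z [xz yz]]; have xy := sim_trans groupG xz (sim_sym yz).
      apply/seteqP; split => w; last exact: sim_trans.
      by apply: (sim_trans groupG); exact: sim_sym.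
    * by move=> _ [x _ <-]; exists x; exact: sim_refl.
  + move=> f [f' fK f'K] fP; apply: closed_mem => //; last by move=> y; exists (f' y).
    apply: (sim_emb groupG (can_inj fK)) => x.
    have : (f @` sim G x) (f x) by exists x => //; exact: sim_refl.
    by rewrite fP //; exists x.
Qed.

Hypotheses (oligoG : oligomorphic G) (countE : countable [set: E]).

Lemma infinite_classes_case :
  ~ finitely_many_classes G -> infinite_set (sib_classes G).
Proof.
move=> inf.
have [c [m cm]] := siblings_large_components groupG closedG oligoG countE inf.
(* steps of length [m + 1] keep the intervals [[d k, d k + m]] disjoint *)
pose d k := (c + k * m.+1).+1.
have /choice[S SP] : forall k, exists S, [/\ sibling G S, big_component G (d k) S &
    forall n, big_component G n S -> (n <= d k + m)%N].
  by move=> k; apply: cm; rewrite ltnS leq_addr.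
pose F k := equivalence_class G (S k).
have FI : injective F.
  have key i j : (i < j)%N -> F i <> F j.
    move=> ij Fij; have : F i (S j) by rewrite Fij; exact: equivalent_refl.
    move=> /equivalent_sym eji; have [_ Bj _] := SP j; have [_ _ Bi] := SP i.
    have := Bi _ (equivalent_big_component eji Bj).
    rewrite leqNgt /d addSn ltnS -addnA ltn_add2l.
    by rewrite (leq_trans _ (_ : i.+1 * m.+1 <= _)%N) // ?leq_mul2r ?ij ?orbT // mulSn addnC addSn ltnS.
  by move=> i j Fij; case: (ltngtP i j) => // /key; [case|case/(_ (esym Fij))].
apply: (@sub_infinite_set _ (F @` setT)).
  by move=> _ [k _ <-]; exists (S k) => //; apply/siblingsP; case: (SP k).
have /eq_finite_set FE : F @` setT #= [set: nat] by apply: inj_card_eq => i j _ _; exact: FI.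
by rewrite FE; exact: infinite_nat.
Qed.

End Classes.

Theorem theorem1p2 (E : Type) (G : set (E -> E))
    (countE : countable [set: E]) (groupG : perm_group G)
    (closedG : closed_group G) (oligoG : oligomorphic G) :
  equivalence_class G setT = copies G /\
  ([/\ sib_classes G #= `I_1,
       weak_class G setT = equivalence_class G setT &
       exists P : set (set E),
         [/\ finite_set P,
             partition P id [set: E] &
             forall f : E -> E, bijective f ->
               (forall B, P B -> f @` B = B) -> G f]]
   \/
   [/\ infinite_set (sib_classes G) &
       exists K : set (set (set E)),
         [/\ infinite_set K,
             K `<=` range (equivalence_class G) &
             weak_class G setT = \bigcup_(c in K) c]]).
Proof.
(* lists of points require a choice structure on [E], given by classical choice *)
pose T : choiceType := {classic E}.
split; first exact: (@equivalence_class_copies T G groupG).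
have [fc|inf] := pselect (@finitely_many_classes T G).
  by left; exact: (@finite_classes_case T G groupG closedG fc).
have infS := @infinite_classes_case T G groupG closedG oligoG countE inf.
right; split => //; exists (sib_classes G); split => //.
  by move=> _ [S _ <-]; exists S.
exact: (@weak_class_bigcup T G groupG).
Qed.
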